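(* Let $(N,\mu,\eta)$ be a magmad on the category of sets satisfying the principles of the normalized stochastic magmadic metalanguage (listed as (P1)–(P5)). Let $U,X,Z,Y$ be sets and let $\mathsf{P}\in N(X\times Z\times Y)$ admit a factorization $$\mathsf{P}=\text{do \{ } g\leftarrow\mathsf{G};\ s\leftarrow\mathsf{S}(g);\ t\leftarrow\mathsf{T}(s);\ c\leftarrow\mathsf{C}(t,g);\ \text{return }(s,t,c)\text{ \}}$$ with $\mathsf{G}\in N(U)$, $\mathsf{S}\colon U\to N(X)$, $\mathsf{T}\colon X\to N(Z)$, $\mathsf{C}\colon Z\times U\to N(Y)$ all total. Assume moreover that $\mathsf{T}$ has full support and that do { $g\leftarrow\mathsf{G}$; $s\leftarrow\mathsf{S}(g)$; return $s$ } $\in N(X)$ has full support. Then, for every $a\in X$, the program $$\text{do \{ } g\leftarrow\mathsf{G};\ t\leftarrow\mathsf{T}(a);\ c\leftarrow\mathsf{C}(t,g);\ \text{return }c\text{ \}}$$ is equal to the program do { $(s,t_0,c_0)\leftarrow\mathsf{P}$; $\ \ t\leftarrow$ do { $(s_1,t,c_1)\leftarrow\mathsf{P}$; $()\leftarrow\mathsf{observe}(s_1,a)$; return $t$ }; $\ \ c\leftarrow$ do { $(s_2,t_2,c)\leftarrow\mathsf{P}$; $()\leftarrow\mathsf{observe}(s_2,s)$; $()\leftarrow\mathsf{observe}(t_2,t)$; return $c$ }; $\ \ $return $c$ }.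
   Context: Magmad on sets: an endofunctor $N$ with natural $\eta_X\colon X\to NX$, $\mu_X\colon NNX\to NX$ satisfying both unit laws $\mu_X\circ\eta_{NX}=\mathrm{id}=\mu_X\circ N(\eta_X)$ (associativity not required). Binding: $\beta(t)(f)=\mu(N(f)(t))$ for $t\in NX$, $f\colon X\to NY$. Right do-notation: rightDo { return $\vec x$ } $=\eta(\vec x)$; rightDo { $\vec x\leftarrow e$; rest } $=\beta(e)(\lambda\vec x.\ \text{rightDo \{ rest \}})$. Left do-notation (written do; used throughout): do { $\vec x\leftarrow e_1$; $\vec y\leftarrow e_2$; rest } $=$ do { $(\vec x,\vec y)\leftarrow$ rightDo { $\vec x\leftarrow e_1$; $\vec y\leftarrow e_2$; return $(\vec x,\vec y)$ }; rest }; do { $\vec x\leftarrow e$; return $\vec y$ } $=$ rightDo { $\vec x\leftarrow e$; return $\vec y$ }; do { return $\vec x$ } $=\eta(\vec x)$. Expressions $F,G,H$ may depend on previously bound variables (and other parameters). An equation between sequences of lines means that one may be replaced by the other inside any do-block. Terminology. $F$ is total (stochastic) if do { $\vec x\leftarrow F$; return $()$ } $=$ do { return $()$ }. $F$ is partial (copyable) if do { $\vec x\leftarrow F$; return $(\vec x,\vec x)$ } $=$ do { $\vec x\leftarrow F$; $\vec y\leftarrow F$; return $(\vec x,\vec y)$ }. $F$ has full support if, for all values $\vec x$ (and all inputs of $F$), do { $\vec y\leftarrow F$; $()\leftarrow\mathsf{observe}(\vec x,\vec y)$; return $\vec x$ } $=$ do { return $\vec x$ }. A function is total (has full support) if it is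 so at each input. Principles. (P1) Partial Frobenius: for each set $A$ there is a map $\mathsf{observe}\colon A\times A\to N1$ such that ( $()\leftarrow\mathsf{observe}(a,b)$ ) $=$ ( $()\leftarrow\mathsf{observe}(b,a)$ ), and ( $\vec x\leftarrow F(a)$; $()\leftarrow\mathsf{observe}(a,b)$ ) $=$ ( $()\leftarrow\mathsf{observe}(a,b)$; $\vec x\leftarrow F(b)$ ), for any $F$. (P2) Algebraic disintegration: for every $F\in N(X\times Y)$ (possibly depending on parameters), setting $(dF)(\vec x)=$ do { $(\vec a,\vec y)\leftarrow F$; $()\leftarrow\mathsf{observe}(\vec x,\vec a)$; return $\vec y$ }, one has do { $(\vec x,\vec y)\leftarrow F$; return $(\vec x,\vec y)$ } $=$ do { $(\vec x,\vec y)\leftarrow F$; $\vec y\leftarrow(dF)(\vec x)$; return $(\vec x,\vec y)$ } (the second binding of $\vec y$ shadows the first). (P3) Exchange: ( $\vec x\leftarrow F$; $\vec y\leftarrow G$ ) $=$ ( $\vec y\leftarrow G$; $\vec x\leftarrow F$ ) whenever $\vec x$ does not occur in $G$ and $\vec y$ does not occur in $F$. (P4) Total $F$ may be discarded and partial $F$ may be copied (the equations above), and for every $F$: do { $\vec x\leftarrow F$; return $\vec x$ } $=$ do { $\vec x\leftarrow F$; $\vec y\leftarrow F$; return $\vec x$ }. (P5) Associativity: do { $\vec x\leftarrow F$; $\vec y\leftarrow G$; $\vec z\leftarrow H$; return $(\vec x,\vec y,\vec z)$ } $=$ do { $\vec x\leftarrow F$; $(\vec y,\vec z)\leftarrow$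 do { $\vec y\leftarrow G$; $\vec z\leftarrow H$; return $(\vec y,\vec z)$ }; return $(\vec x,\vec y,\vec z)$ } whenever $F$ is partial, or $G$ is partial, or $H$ is total. *)

(* Defs.v *)
From Stdlib Require Import List.

Set Implicit Arguments.
Unset Strict Implicit.
Unset Printing Implicit Defensive.

(* Sets are types; equality of programs is Leibniz equality. *)
Record magmad := Magmad {
  carrier :> Type -> Type;
  fmap : forall X Y : Type, (X -> Y) -> carrier X -> carrier Y;
  eta : forall X : Type, X -> carrier X;
  mu : forall X : Type, carrier (carrier X) -> carrier X;
  fmap_id : forall (X : Type) (t : carrier X), fmap (fun x => x) t = t;
  fmap_comp : forall (X Y Z : Type) (f : X -> Y) (g : Y -> Z) (t : carrier X),
    fmap (fun x => g (f x)) t = fmap g (fmap f t);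
  eta_natural : forall (X Y : Type) (f : X -> Y) (x : X),
    fmap f (eta x) = eta (f x);
  mu_natural : forall (X Y : Type) (f : X -> Y) (t : carrier (carrier X)),
    fmap f (mu t) = mu (fmap (fmap f) t);
  mu_eta : forall (X : Type) (t : carrier X), mu (eta t) = t;
  mu_fmap_eta : forall (X : Type) (t : carrier X),
    mu (fmap (@eta X) t) = t
}.

Arguments eta {_ _} _.
Arguments mu {_ _} _.

Definition beta (M : magmad) (X Y : Type) (t : M X) (f : X -> M Y) : M Y :=
  mu (fmap f t).

(* The body of a do-block.  The index lists the types of the bound variables,
   one per line; it is fixed in advance, so that neither the number of lines
   nor the types of the variables can depend on their values. *)
Inductive block (M : magmad) (A : Type) : list Type -> Type :=
| Return : A -> block M A nil
| Bind : forall (X : Type) (Xs : list Type),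
    M X -> (X -> block M A Xs) -> block M A (X :: Xs).

Arguments Return {M A} _.
Arguments Bind {M A X Xs} _ _.

Declare Scope do_scope.
Delimit Scope do_scope with do.
Notation "x <- e ;; b" := (Bind e (fun x => b))
  (at level 61, e at next level, right associativity) : do_scope.
Notation "' p <- e ;; b" := (Bind e (fun p => b))
  (at level 61, p pattern, e at next level, right associativity,
   format "' p  <-  e  ;;  b") : do_scope.
Open Scope do_scope.

Definition first_line (M : magmad) (A X : Type) (Xs : list Type)
    (b : block M A (X :: Xs)) : M X :=
  match b in block _ _ l
    return match l with nil => unit | X :: _ => M X end
  with
  | Return _ => tt
  | Bind e _ => e
  end.

Definition other_lines (M : magmad) (A X : Type) (Xs : list Type)
    (b : block M A (X :: Xs)) : X -> block M A Xs :=
  match b in block _ _ l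
    return match l with nil => unit | X :: Xs => X -> block M A Xs end
  with
  | Return _ => tt
  | Bind _ k => k
  end.

Fixpoint rightDo (M : magmad) (A : Type) (Xs : list Type)
    (b : block M A Xs) : M A :=
  match b with
  | Return a => eta a
  | Bind e k => beta e (fun x => rightDo (k x))
  end.

(* The left do-block  x <- e ;; k x,  by recursion on the number of lines
   of k x. *)
Fixpoint leftDo_from (M : magmad) (A : Type) (Xs : list Type) :
    forall X : Type, M X -> (X -> block M A Xs) -> M A :=
  match Xs return forall X : Type, M X -> (X -> block M A Xs) -> M A with
  | nil => fun X e k => rightDo (x <- e ;; k x)
  | Y :: Ys => fun X e k =>
      leftDo_from
        (rightDo (x <- e ;; y <- first_line (k x) ;; Return (x, y)))
        (fun xy => other_lines (k (fst xy)) (snd xy))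
  end.

Definition leftDo (M : magmad) (A : Type) (Xs : list Type)
    (b : block M A Xs) : M A :=
  match b with
  | Return a => eta a
  | Bind e k => leftDo_from e k
  end.

(* [b] and [b'] may replace each other as the end of any do-block.  The lines
   that come before, if there are any, amount by definition of [leftDo] to the
   single line  w <- E  that binds all the previous variables at once; the
   lines that come after are part of [b] and [b']. *)
Definition interchangeable (M : magmad) (W A : Type) (Xs Ys : list Type)
    (b : W -> block M A Xs) (b' : W -> block M A Ys) : Prop :=
  (forall w : W, leftDo (b w) = leftDo (b' w)) /\
  (forall E : M W, leftDo (w <- E ;; b w) = leftDo (w <- E ;; b' w)).

Definition total (M : magmad) (X : Type) (F : M X) : Prop :=
  leftDo (x <- F ;; Return tt) = leftDo (Return tt).

Definition partial (M : magmad) (X : Type) (F : M X) : Prop :=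
  leftDo (x <- F ;; Return (x, x)) = leftDo (x <- F ;; y <- F ;; Return (x, y)).

Definition observation (M : magmad) : Type := forall A : Type, A * A -> M unit.

Definition full_support (M : magmad) (observe : observation M) (X : Type)
    (F : M X) : Prop :=
  forall x : X,
    leftDo (y <- F ;; _ <- observe X (x, y) ;; Return x) = leftDo (Return x).

Definition disintegration (M : magmad) (observe : observation M) (X Y : Type)
    (F : M (X * Y)%type) (x : X) : M Y :=
  leftDo ('(a, y) <- F ;; _ <- observe X (x, a) ;; Return y).

(* In the equations between sequences of lines, [rest] stands for an arbitrary
   end of the do-block. *)
Record normalized_stochastic (M : magmad) (observe : observation M) : Prop := {
  observe_sym :
    forall (W A B : Type) (Xs : list Type) (a b : W -> A)
      (rest : W -> block M B Xs),
    interchangeable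
      (fun w => _ <- observe A (a w, b w) ;; rest w)
      (fun w => _ <- observe A (b w, a w) ;; rest w);
  partial_frobenius :
    forall (W A X B : Type) (Xs : list Type) (a b : W -> A)
      (F : W -> A -> M X) (rest : W -> X -> block M B Xs),
    interchangeable
      (fun w => x <- F w (a w) ;; _ <- observe A (a w, b w) ;; rest w x)
      (fun w => _ <- observe A (a w, b w) ;; x <- F w (b w) ;; rest w x);
  algebraic_disintegration :
    forall (X Y : Type) (F : M (X * Y)%type),
    leftDo ('(x, y) <- F ;; Return (x, y)) =
    leftDo ('(x, y) <- F ;; y <- disintegration observe F x ;; Return (x, y));
  exchange :
    forall (W X Y B : Type) (Xs : list Type) (F : W -> M X) (G : W -> M Y)
      (rest : W -> X -> Y -> block M B Xs),
    interchangeable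
      (fun w => x <- F w ;; y <- G w ;; rest w x y)
      (fun w => y <- G w ;; x <- F w ;; rest w x y);
  total_discard :
    forall (W X B : Type) (Xs : list Type) (F : W -> M X)
      (rest : W -> block M B Xs),
    (forall w : W, total (F w)) ->
    interchangeable (fun w => x <- F w ;; rest w) (fun w => rest w);
  partial_copy :
    forall (W X B : Type) (Xs : list Type) (F : W -> M X)
      (rest : W -> X -> X -> block M B Xs),
    (forall w : W, partial (F w)) ->
    interchangeable
      (fun w => x <- F w ;; rest w x x)
      (fun w => x <- F w ;; y <- F w ;; rest w x y);
  discard_copy :
    forall (X : Type) (F : M X),
    leftDo (x <- F ;; Return x) = leftDo (x <- F ;; y <- F ;; Return x);
  associativity :
    forall (X Y Z : Type) (F : M X) (G : X -> M Y) (H : X -> Y -> M Z),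
    partial F \/ (forall x : X, partial (G x)) \/
      (forall (x : X) (y : Y), total (H x y)) ->
    leftDo (x <- F ;; y <- G x ;; z <- H x y ;; Return (x, y, z)) =
    leftDo (x <- F ;;
            '(y, z) <- leftDo (y <- G x ;; z <- H x y ;; Return (y, z)) ;;
            Return (x, y, z))
}.

(* Main.v *)
From Stdlib Require Import List FunctionalExtensionality.
Require Import Defs.

(** Write [K t] for the joint law, under [G] and [S], of the treatment [s] and of
    the outcome [C (t, g)] when the mediator is held at [t].  The two inner
    programs that query [P] can be identified.

    - Conditioning [P] on treatment [a] and reading the mediator gives [T a]
      ([intervention_on_mediator]): by Frobenius the observation moves before
      the mediator is drawn, which becomes [T a], and an observation on a law
      with full support has no effect.
    - Conditioning [P] on [s] and on [t] and reading the outcome gives the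
      disintegration of [K t] at [s] ([conditional_outcome]): by Frobenius the
      outcome is drawn from [C (t, g)], and what remains of the mediator is
      [T s] with an observation, which has no effect since [T s] has full
      support.

    Hence the front-door formula says: draw [s], draw [t] from [T a], then redraw
    the outcome from the disintegration of [K t] at [s].  By algebraic
    disintegration, redrawing changes nothing for each fixed [t]
    ([resample_outcome]): [s] followed by the redrawn outcome has the same
    effect as drawing the outcome with the very [g] that produced [s].  This
    gives the left-hand program, once [s] is discarded.

    The point that needs care is that [t] is itself random, while sequencing is
    not associative: the lines that follow [t <- T a] may be grouped into one
    program depending on [t] because they are total ([nest_total2]).
    Disintegrations are defined by an observation, so in general they need
    not be total; but the first marginal of [K t] is the law of the treatment, whose
    full support makes the disintegration total ([disintegration_total]).

    The formal counterpart of rewriting inside a do-block consists of two facts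
    on left do-notation: a nested do-block in first position may be flattened
    ([leftDo_append]), and interchangeable sequences of lines stay so below
    further lines ([interchangeable_after]). *)

Set Implicit Arguments.
Unset Strict Implicit.

(** * Binding and pairing in a magmad *)

Lemma beta_eta (M : magmad) (X Y : Type) (h : X -> Y) (t : M X) :
  beta t (fun x => eta (h x)) = fmap h t.
Proof. unfold beta. rewrite fmap_comp. apply mu_fmap_eta. Qed.

Lemma beta_fmap (M : magmad) (X Y V : Type) (h : X -> Y) (t : M X)
    (f : Y -> M V) :
  beta (fmap h t) f = beta t (fun x => f (h x)).
Proof. unfold beta. now rewrite <- fmap_comp. Qed.

Lemma fmap_beta (M : magmad) (X Y V : Type) (h : Y -> V) (t : M X)
    (f : X -> M Y) :
  fmap h (beta t f) = beta t (fun x => fmap h (f x)).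
Proof. unfold beta. now rewrite mu_natural, <- fmap_comp. Qed.

Lemma eta_beta (M : magmad) (X Y : Type) (x : X) (f : X -> M Y) :
  beta (eta x) f = f x.
Proof. unfold beta. now rewrite eta_natural, mu_eta. Qed.

(** The single line into which left do-notation compresses its first two. *)
Definition joint (M : magmad) (X Y : Type) (e : M X) (f : X -> M Y) :
    M (X * Y)%type :=
  rightDo (x <- e ;; y <- f x ;; Return (x, y)).

Lemma jointE (M : magmad) (X Y : Type) (e : M X) (f : X -> M Y) :
  joint e f = beta e (fun x => fmap (pair x) (f x)).
Proof.
unfold joint; simpl; f_equal.
apply functional_extensionality; intro x; apply beta_eta.
Qed.

Lemma joint_fmap (M : magmad) (V X Y : Type) (h : V -> X) (e : M V)
    (f : X -> M Y) :
  joint (fmap h e) f =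
  fmap (fun vy => (h (fst vy), snd vy)) (joint e (fun v => f (h v))).
Proof.
rewrite !jointE, beta_fmap, fmap_beta; f_equal.
apply functional_extensionality; intro v; now rewrite <- fmap_comp.
Qed.

Lemma joint_eta (M : magmad) (X Y : Type) (x : X) (f : X -> M Y) :
  joint (eta x) f = fmap (pair x) (f x).
Proof. now rewrite jointE, eta_beta. Qed.

(** * Flattening left do-blocks *)

Definition result (M : magmad) (A : Type) (b : block M A nil) : A :=
  match b in block _ _ l return match l with nil => A | _ => unit end with
  | Return a => a
  | Bind _ _ => tt
  end.

Lemma block_nil (M : magmad) (A : Type) (b : block M A nil) :
  b = Return (result b).
Proof.
exact (match b as b0 in block _ _ l
  return match l return block M A l -> Prop with
         | nil => fun b => b = Return (result b) | _ => fun _ => True end b0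
  with Return _ => eq_refl | Bind _ _ => I end).
Qed.

Lemma block_cons (M : magmad) (A X : Type) (Xs : list Type)
    (b : block M A (X :: Xs)) :
  b = Bind (first_line b) (other_lines b).
Proof.
exact (match b as b0 in block _ _ l
  return match l return block M A l -> Prop with
         | nil => fun _ => True
         | X :: Xs => fun b => b = Bind (first_line b) (other_lines b) end b0
  with Return _ => I | Bind _ _ => eq_refl end).
Qed.

Lemma leftDo_from_nil (M : magmad) (A X : Type) (e : M X)
    (k : X -> block M A nil) :
  leftDo_from e k = fmap (fun x => result (k x)) e.
Proof.
simpl. rewrite <- beta_eta; f_equal.
apply functional_extensionality; intro x; now rewrite (block_nil (k x)).
Qed.

(** Deterministic relabelling of the bound variables can be absorbed by the
    lines that follow, because [joint] commutes with it. *)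
Lemma leftDo_from_fmap (M : magmad) (A : Type) (Xs : list Type) :
  forall (V X : Type) (h : V -> X) (e : M V) (k : X -> block M A Xs),
  leftDo_from (fmap h e) k = leftDo_from e (fun v => k (h v)).
Proof.
induction Xs as [|Y Ys IH]; intros V X h e k.
- now rewrite !leftDo_from_nil, <- fmap_comp.
- exact (eq_trans (f_equal (fun j => leftDo_from j _)
      (joint_fmap h e (fun x => first_line (k x)))) (IH _ _ _ _ _)).
Qed.

Lemma leftDo_eta (M : magmad) (A X : Type) (Xs : list Type) (x : X)
    (k : X -> block M A Xs) :
  leftDo (x <- eta x ;; k x) = leftDo (k x).
Proof.
destruct Xs as [|Y Ys]; simpl.
- now rewrite eta_beta, (block_nil (k x)).
- rewrite (block_cons (k x)); simpl.
  exact (eq_trans (f_equal (fun j => leftDo_from j _)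
      (joint_eta x (fun x => first_line (k x)))) (leftDo_from_fmap _ _ _)).
Qed.

Fixpoint append (M : magmad) (A B : Type) (Xs Ys : list Type)
    (b : block M A Xs) (k : A -> block M B Ys) : block M B (Xs ++ Ys) :=
  match b in block _ _ l return block M B (l ++ Ys) with
  | Return a => k a
  | Bind e c => Bind e (fun x => append (c x) k)
  end.

Lemma leftDo_from_append (M : magmad) (A B : Type) (Xs Ys : list Type) :
  forall (X : Type) (e : M X) (c : X -> block M A Xs) (k : A -> block M B Ys),
  leftDo_from (leftDo_from e c) k = leftDo_from e (fun x => append (c x) k).
Proof.
induction Xs as [|V Vs IH]; intros X e c k.
- rewrite leftDo_from_nil, leftDo_from_fmap; f_equal.
  apply functional_extensionality; intro x; now rewrite (block_nil (c x)).
- refine (eq_trans (IH _ _ _ _) _).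
  replace c with (fun x => Bind (first_line (c x)) (other_lines (c x)));
    [reflexivity|].
  apply functional_extensionality; intro x; symmetry; apply block_cons.
Qed.

(** Left do-notation groups lines to the left, so a nested do-block in first
    position computes the same grouping as the flattened block. *)
Lemma leftDo_append (M : magmad) (A B : Type) (Xs Ys : list Type)
    (b : block M A Xs) (k : A -> block M B Ys) :
  leftDo (a <- leftDo b ;; k a) = leftDo (append b k).
Proof.
destruct b as [a|X Xs e c]; [apply leftDo_eta | apply leftDo_from_append].
Qed.

(** * Rewriting inside do-blocks *)

(** The variables of the context and the one bound by the new line together form
    a larger context.  For the equation without preceding lines, the context [w]
    is a constant, which the deterministic relabelling [pair w] adds to [F w]. *)
Lemma interchangeable_after (M : magmad) (W X A : Type) (Xs Ys : list Type)
    (F : W -> M X) (b : W -> X -> block M A Xs) (b' : W -> X -> block M A Ys) :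
  interchangeable (fun wx => b (fst wx) (snd wx))
                  (fun wx => b' (fst wx) (snd wx)) ->
  interchangeable (fun w => x <- F w ;; b w x) (fun w => x <- F w ;; b' w x).
Proof.
intros [_ H]; split.
- intro w.
  generalize (H (fmap (pair w) (F w))); simpl; now rewrite !leftDo_from_fmap.
- intro E; exact (H (joint E F)).
Qed.

Lemma leftDo_interchange (M : magmad) (A : Type) (Xs Ys : list Type)
    (b : block M A Xs) (b' : block M A Ys) :
  interchangeable (fun _ : unit => b) (fun _ => b') -> leftDo b = leftDo b'.
Proof. intros [H _]; exact (H tt). Qed.

Lemma interchangeable_trans (M : magmad) (W A : Type) (Xs Ys Zs : list Type)
    (b : W -> block M A Xs) (b' : W -> block M A Ys) (b'' : W -> block M A Zs) :
  interchangeable b b' -> interchangeable b' b'' -> interchangeable b b''.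
Proof.
intros [H1 H2] [H1' H2'].
split; [intro w; now rewrite H1 | intro E; now rewrite H2].
Qed.

(** A line that uses no variable bound just above it can move up, one exchange
    at a time. *)
Lemma hoist_two (M : magmad) (observe : observation M)
    (HM : normalized_stochastic observe) (W A X Y V : Type) (Xs : list Type)
    (F : W -> M X) (G : W -> X -> M Y) (K : W -> M V)
    (rest : W -> X -> Y -> V -> block M A Xs) :
  interchangeable
    (fun w => x <- F w ;; y <- G w x ;; v <- K w ;; rest w x y v)
    (fun w => v <- K w ;; x <- F w ;; y <- G w x ;; rest w x y v).
Proof.
apply interchangeable_trans with
  (b' := fun w => x <- F w ;; v <- K w ;; y <- G w x ;; rest w x y v).
- apply interchangeable_after, (exchange HM).
- apply (exchange HM).
Qed.

Lemma hoist_three (M : magmad) (observe : observation M)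
    (HM : normalized_stochastic observe) (W A X Y Z V : Type) (Xs : list Type)
    (F : W -> M X) (G : W -> X -> M Y) (H : W -> X -> Y -> M Z) (K : W -> M V)
    (rest : W -> X -> Y -> Z -> V -> block M A Xs) :
  interchangeable
    (fun w => x <- F w ;; y <- G w x ;; z <- H w x y ;; v <- K w ;;
              rest w x y z v)
    (fun w => v <- K w ;; x <- F w ;; y <- G w x ;; z <- H w x y ;;
              rest w x y z v).
Proof.
apply interchangeable_trans with
  (b' := fun w => x <- F w ;; v <- K w ;; y <- G w x ;; z <- H w x y ;;
                  rest w x y z v).
- apply interchangeable_after, (hoist_two HM).
- apply (exchange HM).
Qed.

(** A line that destructs a pair is a [match] on the bound variable, below which
    the lines that follow are hidden; projections expose them. *)
Lemma bind_pair (M : magmad) (A X Y : Type) (Xs : list Type) (F : M (X * Y)%type)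
    (b : X -> Y -> block M A Xs) :
  Bind F (fun '(x, y) => b x y) = Bind F (fun p => b (fst p) (snd p)).
Proof. f_equal; apply functional_extensionality; now intros [x y]. Qed.

(** Naturality: a deterministic function applied to the variables bound last
    may be computed inside a nested block. *)
Lemma leftDo_nest_return (M : magmad) (A X Y : Type) (F : M X) (Q : X -> M Y)
    (f : Y -> A) :
  leftDo (x <- F ;; y <- Q x ;; Return (f y)) =
  leftDo (x <- F ;; v <- leftDo (y <- Q x ;; Return (f y)) ;; Return v).
Proof.
change (leftDo_from (joint F Q) (fun p => Return (f (snd p))) =
  leftDo_from (joint F (fun x => leftDo_from (Q x) (fun y => Return (f y))))
    (fun p => Return (snd p))).
rewrite !leftDo_from_nil, !jointE, !fmap_beta; f_equal.
apply functional_extensionality; intro x.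
now rewrite leftDo_from_nil, <- !fmap_comp.
Qed.

(** * Grouping total lines *)

(** The associativity principle concerns blocks that return all their variables;
    arbitrary lines [rest] can be appended to both of its sides by flattening. *)
Lemma nest_total (M : magmad) (observe : observation M)
    (HM : normalized_stochastic observe) (A X Y Z : Type) (Xs : list Type)
    (F : M X) (G : X -> M Y) (H : X -> Y -> M Z)
    (rest : X -> Y -> Z -> block M A Xs) :
  (forall x y, total (H x y)) ->
  leftDo (x <- F ;; y <- G x ;; z <- H x y ;; rest x y z) =
  leftDo (x <- F ;; p <- leftDo (y <- G x ;; z <- H x y ;; Return (y, z)) ;;
          rest x (fst p) (snd p)).
Proof.
intro HH.
transitivity (leftDo
  (q <- leftDo (x <- F ;; y <- G x ;; z <- H x y ;; Return (x, y, z)) ;;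
   rest (fst (fst q)) (snd (fst q)) (snd q))).
{ now rewrite leftDo_append. }
rewrite (associativity HM (F := F) (G := G) (H := H) (or_intror (or_intror HH))).
replace (leftDo (x <- F ;;
   '(y, z) <- leftDo (y <- G x ;; z <- H x y ;; Return (y, z)) ;;
    Return (x, y, z)))
  with (leftDo (x <- F ;;
   p <- leftDo (y <- G x ;; z <- H x y ;; Return (y, z)) ;;
    Return (x, fst p, snd p))).
- now rewrite leftDo_append.
- do 2 f_equal; apply functional_extensionality; intro x.
  symmetry; apply bind_pair.
Qed.

(** Both groupings have a total last line: first [y] and [z], with [z] total,
    then the pair and [v], with [v] total. *)
Lemma nest_total2 (M : magmad) (observe : observation M)
    (HM : normalized_stochastic observe) (X Y Z V : Type)
    (F : M X) (G : X -> M Y) (H : X -> Y -> M Z) (K : X -> Y -> Z -> M V) :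
  (forall x y, total (H x y)) -> (forall x y z, total (K x y z)) ->
  leftDo (x <- F ;; y <- G x ;; z <- H x y ;; v <- K x y z ;; Return v) =
  leftDo (x <- F ;;
          v <- leftDo (y <- G x ;; z <- H x y ;; v <- K x y z ;; Return v) ;;
          Return v).
Proof.
intros HH HK.
rewrite (nest_total HM F G (fun x y z => v <- K x y z ;; Return v) HH).
rewrite (nest_total HM F (H := fun x p => K x (fst p) (snd p)) _
  (fun x p v => Return v) (fun x p => HK _ _ _)).
rewrite leftDo_nest_return.
do 2 f_equal; apply functional_extensionality; intro x; f_equal.
rewrite leftDo_append; cbn [append app]; now rewrite leftDo_append.
Qed.

(** * Full support and disintegration *)

(** Full support is stated for a block that returns the observed value; since
    left do-notation flattens, the equation can be continued by any lines that
    do not use the drawn value. *)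
Lemma observe_full_support (M : magmad) (observe : observation M)
    (HM : normalized_stochastic observe) (A X : Type) (Xs : list Type)
    (F : M X) (x : X) (rest : block M A Xs) :
  full_support observe F ->
  leftDo (y <- F ;; _ <- observe X (y, x) ;; rest) = leftDo rest.
Proof.
intro HF.
transitivity (leftDo (y <- F ;; _ <- observe X (x, y) ;; rest)).
{ apply leftDo_interchange, interchangeable_after, (observe_sym HM). }
transitivity (leftDo (_ <- leftDo (y <- F ;; _ <- observe X (x, y) ;; Return x) ;;
                      rest)).
{ now rewrite leftDo_append. }
rewrite (HF x). apply leftDo_eta.
Qed.

(** Discarding the second component leaves an observation of [x] on the first
    marginal, which has no effect when that marginal has full support. *)
Lemma disintegration_total (M : magmad) (observe : observation M)
    (HM : normalized_stochastic observe) (X Y : Type) (F : M (X * Y)%type)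
    (x : X) :
  full_support observe (leftDo (p <- F ;; Return (fst p))) ->
  total (disintegration observe F x).
Proof.
intro HF; unfold total, disintegration.
rewrite bind_pair, leftDo_append; cbn [append app].
transitivity (leftDo (p <- F ;; _ <- observe X (fst p, x) ;; Return tt)).
{ apply leftDo_interchange, interchangeable_after, (observe_sym HM). }
rewrite <- (observe_full_support HM x (Return tt) HF).
now rewrite leftDo_append.
Qed.

(** * The front-door adjustment *)

(** Once the outcome is discarded, Frobenius turns [T s1] followed by the
    observation of [s1] at [a] into that observation followed by [T a]; then only
    the treatment's full support is left to use. *)
Lemma intervention_on_mediator (M : magmad) (observe : observation M)
    (HM : normalized_stochastic observe) (U X Z Y : Type)
    (G : M U) (S : U -> M X) (T : X -> M Z) (C : Z * U -> M Y) (a : X) :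
  (forall tg, total (C tg)) ->
  full_support observe (leftDo (g <- G ;; s <- S g ;; Return s)) ->
  leftDo ('(s1, t, c1) <- leftDo (g <- G ;; s <- S g ;; t <- T s ;;
                                  c <- C (t, g) ;; Return (s, t, c)) ;;
          _ <- observe X (s1, a) ;; Return t) = T a.
Proof.
intros HC HGS.
rewrite leftDo_append; cbn [append app].
transitivity (leftDo (g <- G ;; s <- S g ;; t <- T s ;; _ <- observe X (s, a) ;;
                      Return t)).
{ apply leftDo_interchange; do 3 apply interchangeable_after.
  apply (total_discard HM); intro w; apply HC. }
transitivity (leftDo (g <- G ;; s <- S g ;; _ <- observe X (s, a) ;; t <- T a ;;
                      Return t)).
{ apply leftDo_interchange; do 2 apply interchangeable_after.
  apply (partial_frobenius HM) with (F := fun _ s => T s) (b := fun _ => a). }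
transitivity (leftDo (t <- T a ;; Return t)).
{ rewrite <- (observe_full_support HM a (t <- T a ;; Return t) HGS).
  now rewrite leftDo_append. }
simpl; rewrite beta_eta; apply fmap_id.
Qed.

(** Frobenius replaces [t2] by [t] in [C] and [s2] by [s] in [T].  The line
    [T s] and its observation then depend on no previous line; they must be
    hoisted to the very top before full support of [T s] can remove them, since
    an observation need not be total, so it cannot be grouped with [T s] below
    other lines. *)
Lemma conditional_outcome (M : magmad) (observe : observation M)
    (HM : normalized_stochastic observe) (U X Z Y : Type)
    (G : M U) (S : U -> M X) (T : X -> M Z) (C : Z * U -> M Y) (s : X) (t : Z) :
  full_support observe (T s) ->
  leftDo ('(s2, t2, c) <- leftDo (g <- G ;; s <- S g ;; t <- T s ;;
                                  c <- C (t, g) ;; Return (s, t, c)) ;;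
          _ <- observe X (s2, s) ;; _ <- observe Z (t2, t) ;; Return c) =
  disintegration observe
    (leftDo (g <- G ;; s <- S g ;; c <- C (t, g) ;; Return (s, c))) s.
Proof.
intro HT; unfold disintegration.
rewrite !leftDo_append; cbn [append app].
transitivity (leftDo (g <- G ;; s2 <- S g ;; t2 <- T s2 ;;
  _ <- observe X (s2, s) ;; c <- C (t2, g) ;; _ <- observe Z (t2, t) ;;
  Return c)).
{ apply leftDo_interchange; do 3 apply interchangeable_after.
  apply (exchange HM). }
transitivity (leftDo (g <- G ;; s2 <- S g ;; t2 <- T s2 ;;
  _ <- observe X (s2, s) ;; _ <- observe Z (t2, t) ;; c <- C (t, g) ;;
  Return c)).
{ apply leftDo_interchange; do 4 apply interchangeable_after.
  apply (partial_frobenius HM) with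
    (a := fun w => snd (fst w)) (b := fun _ => t)
    (F := fun w t' => C (t', snd (fst (fst (fst w))))). }
transitivity (leftDo (g <- G ;; s2 <- S g ;; _ <- observe X (s2, s) ;;
  t2 <- T s ;; _ <- observe Z (t2, t) ;; c <- C (t, g) ;; Return c)).
{ apply leftDo_interchange; do 2 apply interchangeable_after.
  apply (partial_frobenius HM) with (F := fun _ s => T s) (b := fun _ => s). }
transitivity (leftDo (t2 <- T s ;; g <- G ;; s2 <- S g ;;
  _ <- observe X (s2, s) ;; _ <- observe Z (t2, t) ;; c <- C (t, g) ;;
  Return c)).
{ apply leftDo_interchange, (hoist_three HM). }
transitivity (leftDo (t2 <- T s ;; _ <- observe Z (t2, t) ;; g <- G ;;
  s2 <- S g ;; _ <- observe X (s2, s) ;; c <- C (t, g) ;; Return c)).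
{ apply leftDo_interchange, interchangeable_after, (hoist_three HM). }
rewrite (observe_full_support HM t _ HT).
transitivity (leftDo (g <- G ;; s2 <- S g ;; c <- C (t, g) ;;
  _ <- observe X (s2, s) ;; Return c)).
{ apply leftDo_interchange; do 2 apply interchangeable_after.
  apply (exchange HM). }
apply leftDo_interchange; do 3 apply interchangeable_after.
apply (observe_sym HM).
Qed.

(** The second projection of algebraic disintegration. *)
Lemma resample_last (M : magmad) (observe : observation M)
    (HM : normalized_stochastic observe) (X Y : Type) (F : M (X * Y)%type) :
  leftDo (p <- F ;; Return (snd p)) =
  leftDo (p <- F ;; y <- disintegration observe F (fst p) ;; Return y).
Proof.
assert (E :
  leftDo (q <- leftDo ('(x, y) <- F ;; Return (x, y)) ;; Return (snd q)) =
  leftDo (q <- leftDo ('(x, y) <- F ;; y <- disintegration observe F x ;;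
                       Return (x, y)) ;; Return (snd q))).
{ now rewrite (algebraic_disintegration HM F). }
rewrite !bind_pair, !leftDo_append in E; exact E.
Qed.

(** The outcome drawn first, inside the joint law, is shadowed by the redrawn
    one, so totality of [C] lets it be discarded. *)
Lemma resample_outcome (M : magmad) (observe : observation M)
    (HM : normalized_stochastic observe) (U X Y : Type)
    (G : M U) (S : U -> M X) (C : U -> M Y) :
  (forall g, total (C g)) ->
  leftDo (g <- G ;; s <- S g ;; c <- C g ;; Return c) =
  leftDo (g <- G ;; s <- S g ;;
          c <- disintegration observe
                 (leftDo (g <- G ;; s <- S g ;; c <- C g ;; Return (s, c))) s ;;
          Return c).
Proof.
intro HC.
set (K := leftDo (g <- G ;; s <- S g ;; c <- C g ;; Return (s, c))).
transitivity (leftDo (p <- K ;; Return (snd p))).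
{ unfold K; now rewrite leftDo_append. }
rewrite (resample_last HM).
transitivity (leftDo (g <- G ;; s <- S g ;; c0 <- C g ;;
                      c <- disintegration observe K s ;; Return c)).
{ unfold K at 1; now rewrite leftDo_append. }
apply leftDo_interchange; do 2 apply interchangeable_after.
apply (total_discard HM); intro w; apply HC.
Qed.

Theorem theorem5p17 (M : magmad) (observe : observation M)
  (HM : normalized_stochastic observe)
  (U X Z Y : Type) (P : M (X * Z * Y)%type)
  (G : M U) (S : U -> M X) (T : X -> M Z) (C : Z * U -> M Y)
  (HP : P = leftDo (g <- G ;; s <- S g ;; t <- T s ;; c <- C (t, g) ;;
                    Return (s, t, c)))
  (G_total : total G)
  (S_total : forall g : U, total (S g))
  (T_total : forall s : X, total (T s))
  (C_total : forall tg : Z * U, total (C tg))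
  (T_full : forall s : X, full_support observe (T s))
  (GS_full : full_support observe (leftDo (g <- G ;; s <- S g ;; Return s)))
  (a : X) :
  leftDo (g <- G ;; t <- T a ;; c <- C (t, g) ;; Return c) =
  leftDo ('(s, t0, c0) <- P ;;
          t <- leftDo ('(s1, t, c1) <- P ;;
                       _ <- observe X (s1, a) ;;
                       Return t) ;;
          c <- leftDo ('(s2, t2, c) <- P ;;
                       _ <- observe X (s2, s) ;;
                       _ <- observe Z (t2, t) ;;
                       Return c) ;;
          Return c).
Proof.
set (K := fun t => leftDo (g <- G ;; s <- S g ;; c <- C (t, g) ;;
                           Return (s, c))).
(* [D s t] is the outcome redrawn given treatment [s], with mediator [t]. *)
set (D := fun s t => disintegration observe (K t) s).
assert (D_total : forall s t, total (D s t)).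
{ intros s t; apply (disintegration_total HM).
  replace (leftDo (p <- K t ;; Return (fst p)))
    with (leftDo (g <- G ;; s <- S g ;; Return s)); [exact GS_full|].
  unfold K; rewrite leftDo_append; cbn [append app fst]; symmetry.
  apply leftDo_interchange; do 2 apply interchangeable_after.
  apply (total_discard HM); intro w; apply C_total. }
transitivity (leftDo (g <- G ;; s <- S g ;; t <- T a ;; c <- D s t ;; Return c)).
2: {
  rewrite HP, (intervention_on_mediator HM) by assumption.
  rewrite leftDo_append; cbn [append app].
  (* [t0] and [c0] are not used below their lines, and those lines are total. *)
  transitivity (leftDo (g <- G ;; s <- S g ;; t0 <- T s ;; c0 <- C (t0, g) ;;
                        t <- T a ;; c <- D s t ;; Return c)).
  - symmetry.
    apply leftDo_interchange.
    apply interchangeable_trans with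
      (b' := fun _ => g <- G ;; s <- S g ;; t0 <- T s ;;
                      t <- T a ;; c <- D s t ;; Return c).
    + do 3 apply interchangeable_after.
      apply (total_discard HM); intro w; apply C_total.
    + do 2 apply interchangeable_after.
      apply (total_discard HM); intro w; apply T_total.
  - do 2 f_equal; apply functional_extensionality; intro g.
    f_equal; apply functional_extensionality; intro s.
    f_equal; apply functional_extensionality; intro t0.
    f_equal; apply functional_extensionality; intro c0.
    f_equal; apply functional_extensionality; intro t.
    f_equal; symmetry; apply (conditional_outcome HM), T_full. }
transitivity (leftDo (t <- T a ;; g <- G ;; s <- S g ;; c <- C (t, g) ;;
                      Return c)).
{ transitivity (leftDo (t <- T a ;; g <- G ;; c <- C (t, g) ;; Return c)).
  - apply leftDo_interchange, (exchange HM).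
  - symmetry; apply leftDo_interchange; do 2 apply interchangeable_after.
    apply (total_discard HM); intro w; apply S_total. }
transitivity (leftDo (t <- T a ;; g <- G ;; s <- S g ;; c <- D s t ;;
                      Return c)).
2: { symmetry; apply leftDo_interchange, (hoist_two HM). }
(* With [t] drawn first and the rest grouped, the claim is about a fixed [t]. *)
rewrite !(nest_total2 HM) by auto.
do 2 f_equal; apply functional_extensionality; intro t; f_equal.
apply (resample_outcome HM G S); auto.
Qed.
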